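(* Let $n\ge 2$ and let $\mathcal C\subseteq\mathcal D(\mathbb R_+)$ be a class of cost functions. Then: 1. $\mathcal C$ is $n$-player VI-monotone if and only if $\mathcal C\subseteq Q_n(\mathbb R_+)$. 2. $\mathcal C$ is $n$-player strictly VI-monotone if and only if $\mathcal C\subseteq Q_n(\mathbb R_+)\cap\mathcal D_{\mathrm{mc\text{-}si}}(\mathbb R_+)$. 3. $\mathcal C$ is $n$-player strongly VI-monotone if and only if $\mathcal C\subseteq Q_n^{\mathrm{sm}}(\mathbb R_+)$.
   Context: Cost classes. $\mathbb R_+=[0,\infty)$. For $f\in C^2(\mathbb R_+)$ (real-valued) put $\Theta_f(x):=2f'(x)+xf''(x)$ and, with $\gamma_n:=2+\frac{4}{n-1}=\frac{2(n+1)}{n-1}$, $\Delta_f(x):=\gamma_n f'(x)-xf''(x)$. Define - $\mathcal D(\mathbb R_+):=\{f\in C^2(\mathbb R_+): f'(x)\ge 0 \text{ and } \Theta_f(x)\ge 0\ \forall x\in\mathbb R_+\}$; - $Q_n(\mathbb R_+):=\{f\in\mathcal D(\mathbb R_+):\Delta_f(x)\ge 0\ \forall x\in\mathbb R_+\}$; - $Q_n^{\mathrm{sm}}(\mathbb R_+):=\{f\in\mathcal D(\mathbb R_+):\Delta_f(s)>0\text{ and }\Theta_f(s)>0\ \forall s\in\mathbb R_+\}$; - $\mathcal D_{\mathrm{mc\text{-}si}}(\mathbb R_+):=\{f\in\mathcal D(\mathbb R_+): x\mapsto f(x)+xf'(x)\text{ is strictly increasing on every non-degenerate interval}\}$, where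 an interval with boundary points $a,b\in\mathbb R_+$ is non-degenerate if $a<b$. Games. An ($n$-player) atomic splittable congestion game is a tuple $(N,E,(K_i)_{i\in N},(c_e)_{e\in E})$ with player set $N=\{1,\dots,n\}$, a finite resource set $E$, for each player $i$ a convex compact strategy set $K_i\subset\mathbb R_+^E$, and resource cost functions $c_e\in\mathcal D(\mathbb R_+)$. Put $K:=\prod_{i\in N}K_i$; for $x=(x_{i,e})_{i\in N,e\in E}\in K$ the load of $e$ is $\bar x_e:=\sum_{i\in N}x_{i,e}$. The marginal cost operator (VI operator) is $F=(F_{i,e})_{i\in N,e\in E}$ with $F_{i,e}(x):=c_e(\bar x_e)+x_{i,e}c_e'(\bar x_e)$. $\langle\cdot,\cdot\rangle$ and $\|\cdot\|$ are the Euclidean inner product and norm. Universal monotonicity notions. A class $\mathcal C\subseteq\mathcal D(\mathbb R_+)$ is - $n$-player VI-monotone if for every atomic splittable congestion game with $n$ players and all resource costs in $\mathcal C$, $\langle F(x)-F(y),x-y\rangle\ge 0$ for all $x,y\in K$; - $n$-player strictly VI-monotone if for every such game, $\langle F(x)-F(y),x-y\rangle>0$ for all $x,y\in K$ with $x\ne y$; - $n$-player strongly VI-monotone if for every such game there is a constant $\mu>0$ (which may depend on the game) with $\langle F(x)-F(y),x-y\rangle\ge\mu\|x-y\|^2$ for all $x,y\in K$. *)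

(* Defs.v *)
From mathcomp Require Import all_boot all_order all_algebra.
From mathcomp Require Import all_classical all_reals all_analysis.

Set Implicit Arguments.
Unset Strict Implicit.
Unset Printing Implicit Defensive.

Import Order.TTheory GRing.Theory Num.Theory.
Import numFieldNormedType.Exports.

Local Open Scope classical_set_scope.
Local Open Scope ring_scope.

Section CostClasses.
Context {R : realType}.
Implicit Types (f : R -> R) (x : R) (n : nat).

Definition Rplus : set R := [set x | 0 <= x].

(* A function on R_+ is represented by a total function R -> R whose values at
   negative arguments are irrelevant: the difference quotient is only taken
   along points of R_+, so that the derivative at 0 is the right derivative. *)
Definition diff_quotient f x : R -> R := fun y => (f y - f x) / (y - x).

Definition derivable_plus f x : Prop :=
  cvg (diff_quotient f x @ within Rplus x^').

Definition deriv_plus f x : R := lim (diff_quotient f x @ within Rplus x^').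

Definition C2_plus : set (R -> R) :=
  [set f | [/\ forall x, Rplus x -> derivable_plus f x,
               forall x, Rplus x -> derivable_plus (deriv_plus f) x &
               {within Rplus, continuous (deriv_plus (deriv_plus f))}]].

Definition Theta f x : R := 2 * deriv_plus f x + x * deriv_plus (deriv_plus f) x.

Definition gamma n : R := 2 + 4 / (n%:R - 1).

Definition Delta n f x : R :=
  gamma n * deriv_plus f x - x * deriv_plus (deriv_plus f) x.

Definition cost_class : set (R -> R) :=
  [set f | C2_plus f /\
           forall x, Rplus x -> 0 <= deriv_plus f x /\ 0 <= Theta f x].

Definition Q_class n : set (R -> R) :=
  [set f | cost_class f /\ forall x, Rplus x -> 0 <= Delta n f x].

Definition Q_sm_class n : set (R -> R) :=
  [set f | cost_class f /\
           forall s, Rplus s -> 0 < Delta n f s /\ 0 < Theta f s].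

Definition marginal_cost f x : R := f x + x * deriv_plus f x.

(* The booleans l and r range over the four kinds of intervals (open, closed,
   half-open) with boundary points a and b. *)
Definition mc_si_class : set (R -> R) :=
  [set f | cost_class f /\
     forall (l r : bool) (a b : R), Rplus a -> Rplus b -> a < b ->
       {in Interval (BSide l a) (BSide r b) &,
         {homo marginal_cost f : x y / x < y}}].

End CostClasses.

(* Convexity uses R^o, that is R as a module over itself; compactness is with
   respect to the topology of pointwise convergence, which on functions over a
   finite type is the Euclidean one. *)
Record congestion_game (R : realType) (n : nat) := CongestionGame {
  resource : finType;
  strategies : 'I_n -> set (resource -> R);
  cost : resource -> R -> R;
  strategies_ge0 : forall i u, strategies i u -> forall e, 0 <= u e;
  strategies_convex : forall i,
    convex_set (strategies i : set (convex_lmodType (resource -> R^o)));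
  strategies_compact : forall i,
    compact (strategies i : set {ptws resource -> R});
  cost_classP : forall e, cost_class (cost e)
}.

Arguments strategies {R n} _ _ _.
Arguments cost {R n} _ _ _.

Section Game.
Context {R : realType} {n : nat} (G : congestion_game R n).

Definition profile : Type := 'I_n -> resource G -> R.

Implicit Types (x y u v : profile).

Definition feasible : set profile := [set x | forall i, strategies G i (x i)].

Definition load x (e : resource G) : R := \sum_(i < n) x i e.

Definition VI_operator x : profile :=
  fun i e => cost G e (load x e) + x i e * deriv_plus (cost G e) (load x e).

Definition sub_profile u v : profile := fun i e => u i e - v i e.

Definition inner u v : R := \sum_(i < n) \sum_(e : resource G) u i e * v i e.

Definition enorm u : R := Num.sqrt (inner u u).

Definition VI_gap x y : R :=
  inner (sub_profile (VI_operator x) (VI_operator y)) (sub_profile x y).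

End Game.

Section Universal.
Context {R : realType} (n : nat) (C : set (R -> R)).

Definition VI_monotone : Prop :=
  forall G : congestion_game R n, (forall e, C (cost G e)) ->
    forall x y : profile G, feasible x -> feasible y -> 0 <= VI_gap x y.

Definition strictly_VI_monotone : Prop :=
  forall G : congestion_game R n, (forall e, C (cost G e)) ->
    forall x y : profile G, feasible x -> feasible y -> x <> y ->
      0 < VI_gap x y.

Definition strongly_VI_monotone : Prop :=
  forall G : congestion_game R n, (forall e, C (cost G e)) ->
    exists2 mu : R, 0 < mu &
      forall x y : profile G, feasible x -> feasible y ->
        mu * enorm (sub_profile x y) ^+ 2 <= VI_gap x y.

End Universal.

(* Main.v *)
Require Import Defs.
From mathcomp Require Import all_boot all_order all_algebra ring lra.
From mathcomp Require Import all_classical all_reals all_analysis.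

Set Implicit Arguments.
Unset Strict Implicit.
Unset Printing Implicit Defensive.

Import Order.TTheory GRing.Theory Num.Theory.
Import numFieldNormedType.Exports.

Local Open Scope classical_set_scope.
Local Open Scope ring_scope.

(** Everything reduces to one resource, since the gap of two profiles is the sum
    over the resources of [resource_gap], and to the Jacobian of the marginal
    cost operator, since by the mean value theorem along a segment the gap is a
    value of the quadratic form [jacobian_form] at an interior point of the
    segment ([resource_gap_MVT]).

    The Jacobian form at [x] in direction [v] is
    [c' (X) (V^2 + |v|^2) + c'' (X) V <x, v>], where [X] and [V] are the sums of
    [x] and [v]. It is affine in [x] for a given load [X], so its sign is decided
    where one player [k] carries the whole load; there it is linear in the pair
    [(c', X c'')], which ranges over the cone [Theta >= 0, Delta >= 0]. On the two
    edges of this cone the form is, up to a factor, [V^2 + |v|^2 + s v_k V] with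
    [s = gamma n] or [s = -2], and both are nonnegative: the number [gamma n] is
    the largest [s] for which this is the case. The lemma [jacobian_form_cone]
    records this decomposition, and positivity ([jacobian_form_ge0]), uniform
    positivity ([jacobian_form_ge]) and strict positivity ([jacobian_form_gt0])
    follow from it.

    For strong monotonicity, [Theta] and [Delta] are bounded below by a positive
    constant on the compact interval of possible loads. For strict monotonicity,
    the derivative along a segment only has to be positive at one point; strictly
    increasing marginal costs provide it, because [Theta] is the derivative of
    the marginal cost, and because they force [c' > 0] away from 0, which covers
    the segments of constant load.

    Conversely, take the game with one resource on which each player chooses a
    load in [[0, M]], and profiles near the one where a single player carries the
    load [s]. The direction in which the form on the edge [Delta = 0] vanishes
    ([push_out]) isolates [Delta n c s], and the direction in which only the
    loaded player moves isolates [Theta c s] ([monotone_on_box_Delta],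
    [monotone_on_box_Theta]). Strictness of the gap when a single player changes
    load is strict monotonicity of the marginal cost. *)

(** * One-sided calculus on the half-line *)

Section OneSidedCalculus.
Context {R : realType}.
Implicit Types (f g : R -> R) (x : R).

(** The Caratheodory slope of [f] at [x], completed at [y = x] by the one-sided
    derivative, so that continuity and two-sided differentiability both follow
    from its convergence. *)
Definition slope f x (y : R) : R :=
  if y == x then deriv_plus f x else diff_quotient f x y.

Lemma slopeE f x y : f y = f x + slope f x y * (y - x).
Proof.
rewrite /slope; have [->|yx] := eqVneq y x; first by rewrite subrr mulr0 addr0.
by rewrite /diff_quotient divfK ?subr_eq0// addrC subrK.
Qed.

Lemma slope_cvg f x : derivable_plus f x ->
  slope f x @ within Rplus (nbhs x) --> deriv_plus f x.
Proof.
move=> df A nA.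
have H : \forall y \near within Rplus x^', A (diff_quotient f x y) := df A nA.
rewrite !near_withinE in H.
suff : \forall y \near within Rplus (nbhs x), A (slope f x y) by [].
rewrite near_withinE; apply: filterS H => y H y0.
rewrite /slope; case: eqVneq => [_|yx]; last exact: H.
exact: nbhs_singleton nA.
Qed.

Lemma derivable_plus_continuous f :
  (forall x, Rplus x -> derivable_plus f x) -> {within Rplus, continuous f}.
Proof.
move=> df; apply/subspace_continuousP => x x0.
have fE : f = fun y => f x + slope f x y * (y - x).
  by rewrite funeqE; exact: slopeE.
suff : (fun y => f x + slope f x y * (y - x)) @ within Rplus (nbhs x) -->
       f x + deriv_plus f x * (x - x) by rewrite -fE subrr mulr0 addr0.
apply: cvgD; first exact: cvg_cst.
apply: cvgM; first exact: slope_cvg (df x x0).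
by apply: cvgB; [exact: cvg_within|exact: cvg_cst].
Qed.

(** At an interior point of the half-line the filter of punctured neighbourhoods
    is insensitive to the restriction to [Rplus], so that the one-sided
    derivative is the usual one. *)
Lemma derivable_plus_is_derive f x :
  0 < x -> derivable_plus f x -> is_derive x 1 f (deriv_plus f x).
Proof.
move=> x0 df; have sx : slope f x x = deriv_plus f x by rewrite /slope eqxx.
apply/is_derive1_caratheodory; exists (slope f x).
split=> //; first by move=> z; rewrite (slopeE f x) addrC addKr.
rewrite /prop_for /continuous_at sx => A nA.
have H : \forall y \near within Rplus (nbhs x), A (slope f x y) := slope_cvg df nA.
rewrite near_withinE in H.
suff : \forall y \near x, A (slope f x y) by [].
have P : \forall y \near x, Rplus y by near=> y; apply: ltW; near: y; exact: lt_nbhsr.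
by apply: filterS2 P H => y y0; apply.
Unshelve. all: by end_near. Qed.

Lemma within_Rplus_comp f (h : R -> R) a b :
  {within Rplus, continuous f} -> continuous h ->
  (forall t, t \in `[a, b] -> 0 <= h t) ->
  {within `[a, b], continuous (f \o h)}.
Proof.
move=> /subspace_continuousP cf ch h0; apply/subspace_continuousP => t tab.
apply: cvg_comp (cf _ (h0 t tab)).
move=> A nA.
have H : \forall s \near within Rplus (nbhs (h t)), A s by exact: nA.
rewrite near_withinE in H.
suff : \forall s \near within `[a, b] (nbhs t), A (h s) by [].
have Hh : \forall s \near t, Rplus (h s) -> A (h s) := ch t _ H.
rewrite near_withinE; apply: filterS Hh => s As sab.
by apply: As; exact: h0.
Qed.

(** Turns a bound on finite differences into a bound on the derivative; only the
    secants on one side are used, which is all that a deviation towards the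
    interior of a strategy set provides. *)
Lemma is_derive_ge_secant g (a d mu e : R) : is_derive a 1 g d -> 0 < e ->
  (forall t, 0 < t < e -> mu * t <= g (a + t) - g a) -> mu <= d.
Proof.
move=> [dg <-] e0 H.
have cg : (fun h => h^-1 *: (g (h *: (1 : R) + a) - g a)) @ 0^'+ --> 'D_1 g a.
  by apply: cvg_dnbhs_at_right; exact: dg.
rewrite -(cvg_lim _ cg)//; apply: limr_ge; first by apply/cvg_ex; eexists; exact: cg.
near=> t.
have t0 : 0 < t by near: t; exact: nbhs_right_gt.
rewrite /= /GRing.scale /= mulr1 (addrC t) ler_pdivlMl// mulrC.
apply: H; rewrite t0 /=.
by near: t; exact: nbhs_right_lt.
Unshelve. all: by end_near. Qed.

Lemma is_derive1D_fun (f g : R -> R) x (df dg : R) :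
  is_derive x 1 f df -> is_derive x 1 g dg ->
  is_derive x 1 (fun t => f t + g t) (df + dg).
Proof. by move=> f1 g1; exact: is_deriveD. Qed.

Lemma is_derive1M_fun (f g : R -> R) x (df dg : R) :
  is_derive x 1 f df -> is_derive x 1 g dg ->
  is_derive x 1 (fun t => f t * g t) (df * g x + f x * dg).
Proof.
move=> f1 g1; apply: (is_derive_eq (is_deriveM f1 g1)).
by rewrite /GRing.scale /= addrC mulrC.
Qed.

Lemma is_derive_affine (p q x : R) : is_derive x 1 (fun s => p + s * q) q.
Proof.
apply: (is_derive_eq (is_derive1D_fun (is_derive_cst p x 1)
  (is_derive1M_fun (is_derive_id x 1) (is_derive_cst q x 1)))).
by rewrite mul1r mulr0 addr0 add0r.
Qed.

Lemma within_continuousD_fun (A : set R) (f g : R -> R) :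
  {within A, continuous f} -> {within A, continuous g} ->
  {within A, continuous (fun x => f x + g x)}.
Proof. by move=> cf cg x; apply: cvgD; [exact: cf|exact: cg]. Qed.

Lemma within_continuousB_fun (A : set R) (f g : R -> R) :
  {within A, continuous f} -> {within A, continuous g} ->
  {within A, continuous (fun x => f x - g x)}.
Proof. by move=> cf cg x; apply: cvgB; [exact: cf|exact: cg]. Qed.

Lemma within_continuousM (A : set R) (f g : R -> R) :
  {within A, continuous f} -> {within A, continuous g} ->
  {within A, continuous (fun x => f x * g x)}.
Proof. by move=> cf cg x; apply: cvgM; [exact: cf|exact: cg]. Qed.

Lemma MVT_Rplus (f df : R -> R) (a b : R) : 0 <= a -> a < b ->
  {within Rplus, continuous f} ->
  (forall x, 0 < x -> is_derive x 1 f (df x)) ->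
  exists2 z, a < z < b & f b - f a = df z * (b - a).
Proof.
move=> a0 ab cf fdf; have [||z] := @MVT R f df a b ab.
- move=> x; rewrite in_itv /= => /andP[ax _]; apply: fdf; exact: le_lt_trans ax.
- apply: continuous_subspaceW cf => x /=.
  by rewrite in_itv /= => /andP[ax _]; exact: le_trans ax.
by rewrite in_itv /=; exists z.
Qed.

(** The derivative of a cost is two-sided only at positive points; bounds
    obtained there are extended to 0 by this limit argument. *)
Lemma within_Rplus_ge_at0 (h : R -> R) (mu : R) : {within Rplus, continuous h} ->
  (forall s, 0 < s <= 1 -> mu <= h s) -> mu <= h 0.
Proof.
move=> /subspace_continuousP/(_ 0 (lexx _)) ch H.
rewrite leNgt; apply/negP => hmu.
have : \forall y \near within Rplus (nbhs (0 : R)), h y < mu.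
  exact: (ch [set y | y < mu] (lt_nbhsl hmu)).
rewrite near_withinE => /nbhs_ballP[e /= e0 He].
have s0 : 0 < Num.min 1 (e / 2) by rewrite lt_min ltr01 divr_gt0.
have := H (Num.min 1 (e / 2)); rewrite s0 ge_min lexx /= => /(_ isT).
rewrite leNgt He //; last exact: ltW.
rewrite /ball /= sub0r normrN gtr0_norm //.
by rewrite gt_min; apply/orP; right; lra.
Qed.

(** Compactness of [[0, M]] turns pointwise positivity into a uniform bound;
    this is the source of the constant of strong monotonicity. *)
Lemma within_Rplus_lower_bound (h : R -> R) (M : R) : 0 <= M ->
  {within Rplus, continuous h} -> (forall s, 0 <= s -> 0 < h s) ->
  exists2 e, 0 < e & forall s, 0 <= s <= M -> e <= h s.
Proof.
move=> M0 ch h0; have [|z] := @EVT_min R h 0 M M0.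
  by apply: continuous_subspaceW ch => s /=; rewrite in_itv /= => /andP[].
rewrite in_itv /= => /andP[z0 _] H; exists (h z); first exact: h0.
by move=> s sM; apply: H; rewrite in_itv.
Qed.

(** If [g 0 = g 1], then [g], being nondecreasing, is constant, and its
    derivative could not be positive at [t]. *)
Lemma increasing_of_derive (g dg : R -> R) (t : R) :
  {within `[0, 1], continuous g} ->
  (forall s : R, 0 < s < 1 -> is_derive s 1 g (dg s) /\ 0 <= dg s) ->
  0 < t < 1 -> 0 < dg t -> g 0 < g 1.
Proof.
move=> cg H t01 dt.
have nd (a b : R) : 0 <= a -> a <= b -> b <= 1 -> g a <= g b.
  move=> a0; rewrite le_eqVlt => /orP[/eqP->//|ab] b1.
  have [|| z] := @MVT R g dg a b ab.
  - move=> s; rewrite in_itv /= => /andP[s0 s1].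
    by have [] := H s; first by apply/andP; split; lra.
  - apply: continuous_subspaceW cg => s /=; rewrite !in_itv /= => /andP[s0 s1].
    by apply/andP; split; lra.
  rewrite in_itv /= => /andP[s0 s1] E.
  have [|_ z0] := H z; first by apply/andP; split; lra.
  by rewrite -subr_ge0 E mulr_ge0 // subr_ge0 ltW.
rewrite ltNge; apply/negP => g10.
have gE (s : R) : 0 <= s <= 1 -> g s = g 0.
  case/andP=> s0 s1; apply/eqP; rewrite eq_le (nd 0 s) // andbT.
  by apply: le_trans g10; exact: nd.
have [d _] := H t t01; case/andP: (t01) => t0 t1.
have : 0 <= - dg t; last by rewrite oppr_ge0 leNgt dt.
apply: (@is_derive_ge_secant (- g) t _ 0 (1 - t)); rewrite ?subr_gt0 //.
move=> r /andP[r0 r1]; rewrite mul0r !fctE (gE t); last by rewrite !ltW.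
by rewrite gE ?subrr //; apply/andP; split; lra.
Qed.

End OneSidedCalculus.

(** * Regularity of cost functions *)

Section CostFunctions.
Context {R : realType}.
Implicit Types (c : R -> R) (x : R).

Lemma C2_continuous c : C2_plus c ->
  [/\ {within Rplus, continuous c}, {within Rplus, continuous (deriv_plus c)} &
      {within Rplus, continuous (deriv_plus (deriv_plus c))}].
Proof. by case=> dc ddc cc; split=> //; exact: derivable_plus_continuous. Qed.

Lemma C2_is_derive c x : C2_plus c -> 0 < x ->
  is_derive x 1 c (deriv_plus c x) /\
  is_derive x 1 (deriv_plus c) (deriv_plus (deriv_plus c) x).
Proof.
case=> dc ddc _ x0.
by split; apply: derivable_plus_is_derive => //; [exact/dc/ltW|exact/ddc/ltW].
Qed.

Lemma Theta_continuous c : C2_plus c -> {within Rplus, continuous (Theta c)}.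
Proof.
move=> /C2_continuous[_ c1 c2]; apply: within_continuousD_fun;
  apply: within_continuousM => //; apply: continuous_subspaceT.
- exact: cst_continuous.
- by move=> ?; exact: cvg_id.
Qed.

Lemma Delta_continuous n c :
  C2_plus c -> {within Rplus, continuous (Delta n c)}.
Proof.
move=> /C2_continuous[_ c1 c2]; apply: within_continuousB_fun;
  apply: within_continuousM => //; apply: continuous_subspaceT.
- exact: cst_continuous.
- by move=> ?; exact: cvg_id.
Qed.

Lemma marginal_cost_continuous c :
  C2_plus c -> {within Rplus, continuous (marginal_cost c)}.
Proof.
move=> /C2_continuous[c0 c1 _]; apply: within_continuousD_fun => //.
apply: within_continuousM => //; apply: continuous_subspaceT.
by move=> ?; exact: cvg_id.
Qed.

(** [Theta] is the derivative of the marginal cost; this ties the nonnegativity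
    of [Theta] to the monotonicity of [marginal_cost]. *)
Lemma marginal_cost_is_derive c x : C2_plus c -> 0 < x ->
  is_derive x 1 (marginal_cost c) (Theta c x).
Proof.
move=> c2 x0; have [d1 d2] := C2_is_derive c2 x0.
apply: (is_derive_eq (is_derive1D_fun d1 (is_derive1M_fun (is_derive_id x 1) d2))).
by rewrite /Theta /=; ring.
Qed.

End CostFunctions.

(** * The monotonicity gap of a single resource *)

Section ResourceGap.
Context {R : realType} {n : nat}.
Implicit Types (a b u v x y : 'I_n -> R) (c : R -> R) (t : R).

Definition total u : R := \sum_(i < n) u i.
Definition dot u v : R := \sum_(i < n) u i * v i.
Definition ray y v t : 'I_n -> R := fun i => y i + t * v i.

Definition resource_gap c x y : R :=
  \sum_(i < n) ((c (total x) + x i * deriv_plus c (total x)) -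
                (c (total y) + y i * deriv_plus c (total y))) * (x i - y i).

(** The pairing of the marginal costs at [ray y v t] with the direction [v]: as a
    function of [t], its increments are gaps, and its derivative is
    [jacobian_form]. *)
Definition directional_cost c y v t : R :=
  c (total (ray y v t)) * total v +
  deriv_plus c (total (ray y v t)) * dot (ray y v t) v.

(** The quadratic form [v^T J v], where [J] is the Jacobian matrix at [x] of the
    marginal cost operator of one resource; its entries are
    [c' (X) (1 + [i = j]) + x_i c'' (X)] with [X = total x]. *)
Definition jacobian_form c x v : R :=
  deriv_plus c (total x) * (total v ^+ 2 + dot v v) +
  deriv_plus (deriv_plus c) (total x) * total v * dot x v.

Lemma ray0 y v : ray y v 0 = y.
Proof. by apply/funext => i; rewrite /ray mul0r addr0. Qed.

Lemma total_ray y v t : total (ray y v t) = total y + t * total v.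
Proof. by rewrite /total /ray big_split /= mulr_sumr. Qed.

Lemma dot_ray y v t : dot (ray y v t) v = dot y v + t * dot v v.
Proof.
rewrite /dot /ray mulr_sumr -big_split /=.
by apply: eq_bigr => i _; ring.
Qed.

Lemma dot_ge0 v : 0 <= dot v v.
Proof. by apply: sumr_ge0 => i _; rewrite -expr2 sqr_ge0. Qed.

Definition diff x y : 'I_n -> R := fun i => x i - y i.

Lemma ray_diff x y : ray y (diff x y) 1 = x.
Proof. by apply/funext => i; rewrite /ray /diff mul1r addrC subrK. Qed.

Lemma dot_diff_gt0 x y : x <> y -> 0 < dot (diff x y) (diff x y).
Proof.
move=> xy; rewrite lt_def dot_ge0 andbT; apply/eqP.
move=> /psumr_eq0P H; apply: xy; apply/funext => i.
apply/eqP; rewrite -subr_eq0 -sqrf_eq0 expr2; apply/eqP; apply: H => // j _.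
by rewrite -expr2 sqr_ge0.
Qed.

Lemma resource_gap_diag c x : resource_gap c x x = 0.
Proof. by apply: big1 => i _; rewrite !subrr mulr0. Qed.

Lemma resource_gap_ray c y v t : resource_gap c (ray y v t) y =
  t * (directional_cost c y v t - directional_cost c y v 0).
Proof.
rewrite /directional_cost ray0 /resource_gap.
set X := total (ray y v t); set Y := total y.
rewrite /total /dot !mulr_sumr -!big_split /= -sumrB mulr_sumr.
by apply: eq_bigr => i _; rewrite /ray; ring.
Qed.

Lemma directional_cost_is_derive c y v t : C2_plus c ->
  0 < total (ray y v t) ->
  is_derive t 1 (directional_cost c y v) (jacobian_form c (ray y v t) v).
Proof.
move=> c2 X0; pose L s := total y + s * total v.
have dL : is_derive t 1 L (total v) by exact: is_derive_affine.
have LE s : total (ray y v s) = L s by exact: total_ray.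
rewrite LE in X0; have [d1 d2] := C2_is_derive c2 X0.
have D1 := is_derive1_comp d1 dL; have D2 := is_derive1_comp d2 dL.
rewrite (_ : directional_cost c y v = fun s => (c \o L) s * total v +
  (deriv_plus c \o L) s * (dot y v + s * dot v v)); last first.
  by apply/funext => s; rewrite /directional_cost LE dot_ray.
apply: (is_derive_eq (is_derive1D_fun
  (is_derive1M_fun D1 (is_derive_cst (total v) t 1))
  (is_derive1M_fun D2 (is_derive_affine (dot y v) (dot v v) t)))).
by rewrite /jacobian_form LE dot_ray /=; ring.
Qed.

Lemma directional_cost_continuous c y v : C2_plus c ->
  (forall i, 0 <= y i) -> (forall i, 0 <= ray y v 1 i) ->
  {within `[0, 1], continuous (directional_cost c y v)}.
Proof.
move=> /C2_continuous[c0 c1 _] y0 x0.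
pose L s := total y + s * total v.
have LE s : total (ray y v s) = L s by exact: total_ray.
have cA (p q : R) : continuous (fun s : R => p + s * q).
  move=> s; apply: cvgD; first exact: cvg_cst.
  by apply: cvgM; [exact: cvg_id|exact: cvg_cst].
have cL : continuous L by exact: cA.
have L0 s : s \in `[0, 1] -> 0 <= L s.
  rewrite in_itv /= => /andP[s0 s1].
  have : 0 <= total y by exact: sumr_ge0.
  have : 0 <= L 1 by rewrite -LE; exact: sumr_ge0.
  by rewrite /L; nra.
have C0 := within_Rplus_comp c0 cL L0; have C1 := within_Rplus_comp c1 cL L0.
rewrite (_ : directional_cost c y v = fun s => (c \o L) s * total v +
  (deriv_plus c \o L) s * (dot y v + s * dot v v)); last first.
  by apply/funext => s; rewrite /directional_cost LE dot_ray.
apply: within_continuousD_fun; apply: within_continuousM => //;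
  apply: continuous_subspaceT; [exact: cst_continuous|exact: cA].
Qed.

(** The load can vanish inside a segment of nonnegative vectors only if both ends
    are 0. Hence the one-sided differentiability at load 0 matters only at the
    endpoints, where the mean value theorem asks for continuity alone. *)
Lemma total_ray_gt0 y v t : (forall i, 0 <= y i) ->
  (forall i, 0 <= ray y v 1 i) -> 0 < dot v v -> 0 < t < 1 ->
  0 < total (ray y v t) /\ forall i, 0 <= ray y v t i.
Proof.
move=> y0 x0 vv t01.
have m0 i : 0 <= ray y v t i by have := y0 i; have := x0 i; rewrite /ray; nra.
split=> //; rewrite lt_def sumr_ge0 // andbT; apply/eqP => /psumr_eq0P m0'.
have {}m0' i : ray y v t i = 0 by exact: m0'.
have v0 i : v i = 0.
  by have := m0' i; have := y0 i; have := x0 i; rewrite /ray; nra.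
by move: vv; rewrite /dot big1 ?ltxx // => i _; rewrite v0 mul0r.
Qed.

Lemma resource_gap_MVT c y v : C2_plus c ->
  (forall i, 0 <= y i) -> (forall i, 0 <= ray y v 1 i) -> 0 < dot v v ->
  exists2 t, 0 < t < 1 &
    resource_gap c (ray y v 1) y = jacobian_form c (ray y v t) v.
Proof.
move=> c2 y0 x0 vv.
have [||t] := @MVT R (directional_cost c y v)
  (fun t => jacobian_form c (ray y v t) v) 0 1 ltr01.
- move=> t; rewrite in_itv /= => t01; apply: directional_cost_is_derive => //.
  by have [] := total_ray_gt0 y0 x0 vv t01.
- exact: directional_cost_continuous.
rewrite in_itv /= => t01 H; exists t => //.
by rewrite resource_gap_ray mul1r H subr0 mulr1.
Qed.

(** A lower bound on the gaps of the small deviations along [v] passes to the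
    Jacobian form, since their quotient by [t ^+ 2] is a difference quotient of
    [directional_cost]. *)
Lemma jacobian_form_ge_gap c x v (mu e : R) : C2_plus c -> 0 < total x -> 0 < e ->
  (forall t, 0 < t < e ->
     mu * t ^+ 2 * dot v v <= resource_gap c (ray x v t) x) ->
  mu * dot v v <= jacobian_form c x v.
Proof.
move=> c2 X0 e0 H; rewrite -(ray0 x v).
apply: (@is_derive_ge_secant _ (directional_cost c x v) 0 _ _ e) => //.
  by apply: directional_cost_is_derive => //; rewrite ray0.
move=> t te; have /andP[t0 _] := te.
by rewrite add0r -(ler_pM2l t0) -resource_gap_ray; apply: le_trans (H t te); lra.
Qed.

End ResourceGap.

(** * Positivity of the Jacobian form *)

Section QuadraticForm.
Context {R : realType} {n : nat}.
Context (n_gt1 : (1 < n)%N).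
Implicit Types (v x : 'I_n -> R) (c : R -> R) (k : 'I_n).

(** The Jacobian form in the normalization [c' (X) = 1], [X * c'' (X) = s], when
    player [k] carries the whole load [X]. The values [s = -2] and [s = gamma n]
    are those at which [Theta] and [Delta n] vanish. *)
Definition vertex_form (s : R) v k : R :=
  total v ^+ 2 + dot v v + s * v k * total v.

Lemma gammaE : (gamma n : R) * (n%:R - 1) = 2 * (n%:R + 1).
Proof.
have n1 : (1 : R) < n%:R by rewrite ltr1n.
by rewrite /gamma; field; rewrite lt0r_neq0 // subr_gt0.
Qed.

Lemma gamma_ge2 : 2 <= (gamma n : R).
Proof.
have n1 : (1 : R) < n%:R by rewrite ltr1n.
by rewrite /gamma lerDl divr_ge0 // subr_ge0 ltW.
Qed.

Lemma sum_others_const (a : R) k :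
  \sum_(i < n | i != k) a = a * (n%:R - 1).
Proof.
rewrite sumr_const (_ : #|_| = n.-1); last by have := cardC1 k; rewrite card_ord.
by rewrite -subn1 -[LHS]mulr_natr natrB // ltnW.
Qed.

Lemma total_split v k : total v = v k + \sum_(i < n | i != k) v i.
Proof. by rewrite /total (bigD1 k). Qed.

Lemma dot_split v k : dot v v = v k ^+ 2 + \sum_(i < n | i != k) v i ^+ 2.
Proof. by rewrite /dot (bigD1 k) //= expr2. Qed.

(** The form is the sum of the squares of [total v - v k] and of the [v i] with
    [i != k]. *)
Lemma vertex_formN2_ge0 v k : 0 <= vertex_form (-2) v k.
Proof.
have S0 : 0 <= \sum_(i < n | i != k) v i ^+ 2 by apply: sumr_ge0 => i _; exact: sqr_ge0.
have := sqr_ge0 (\sum_(i < n | i != k) v i).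
by rewrite /vertex_form (dot_split v k) (total_split v k); nra.
Qed.

(** The Cauchy-Schwarz inequality for the [n - 1] players other than [k]. *)
Lemma sum_others_sqr v k :
  (\sum_(i < n | i != k) v i) ^+ 2 <= (n%:R - 1) * \sum_(i < n | i != k) v i ^+ 2.
Proof.
have n1 : (1 : R) < n%:R by rewrite ltr1n.
set W := \sum_(i < n | i != k) v i; set S := \sum_(i < n | i != k) v i ^+ 2.
pose m := W / (n%:R - 1).
have Wm : W = m * (n%:R - 1) by rewrite divfK // subr_eq0 gt_eqF.
have : 0 <= \sum_(i < n | i != k) (v i - m) ^+ 2.
  by apply: sumr_ge0 => i _; exact: sqr_ge0.
have -> : \sum_(i < n | i != k) (v i - m) ^+ 2 =
    S - 2 * m * W + m ^+ 2 * (n%:R - 1).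
  rewrite -(sum_others_const _ k) /S /W mulr_sumr -sumrB -big_split /=.
  by apply: eq_bigr => i _; ring.
by move=> H; rewrite Wm in H *; nra.
Qed.

(** Let [W] be the sum of the [v i] with [i != k]. By Cauchy-Schwarz, the form is
    at least [n / (n - 1) * (2 * v k + W) ^+ 2]: the constant [gamma n] is the
    one for which this lower bound is a perfect square. Equality holds when the
    [v i] with [i != k] agree and [W = - 2 * v k]. *)
Lemma vertex_form_gamma_ge0 v k : 0 <= vertex_form (gamma n) v k.
Proof.
have n1 : (1 : R) < n%:R by rewrite ltr1n.
have := sum_others_sqr v k; have := gammaE.
rewrite /vertex_form (dot_split v k) (total_split v k).
set W := \sum_(i < n | i != k) v i; set S := \sum_(i < n | i != k) v i ^+ 2.
set g := gamma n => gE WS.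
have n0 : 0 < n%:R - 1 :> R by rewrite subr_gt0.
rewrite -(pmulr_rge0 _ n0).
(* Clearing the denominator of gamma n leaves a square plus the defect of the
   Cauchy-Schwarz inequality. *)
have -> : (n%:R - 1) * ((v k + W) ^+ 2 + (v k ^+ 2 + S) + g * v k * (v k + W)) =
    n%:R * (2 * v k + W) ^+ 2 + ((n%:R - 1) * S - W ^+ 2).
  transitivity ((n%:R - 1) * ((v k + W) ^+ 2 + (v k ^+ 2 + S))
    + (g * (n%:R - 1)) * v k * (v k + W)); first by ring.
  by rewrite gE; ring.
by rewrite addr_ge0 ?subr_ge0 // mulr_ge0 ?sqr_ge0.
Qed.

(** The Jacobian form is affine in the distribution of the load among the
    players, hence an average of its values when one player carries the load;
    and the pair of the derivatives of [c] is a combination of the extreme cases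
    [Delta n c = 0] and [Theta c = 0], with [Theta] and [Delta n] as coefficients. *)
Lemma jacobian_form_cone c x v :
  (gamma n + 2) * total x * jacobian_form c x v =
  \sum_(k < n) x k * (Theta c (total x) * vertex_form (gamma n) v k +
                      Delta n c (total x) * vertex_form (-2) v k).
Proof.
rewrite /jacobian_form /Theta /Delta /vertex_form; set X := total x.
set g := gamma n; set d1 := deriv_plus c X; set d2 := deriv_plus (deriv_plus c) X.
set q := total v ^+ 2 + dot v v.
transitivity ((g + 2) * d1 * q * (\sum_(k < n) x k) +
              (g + 2) * X * d2 * total v * \sum_(k < n) x k * v k).
  by rewrite -/(total x) -/(dot x v) -/X; ring.
rewrite [Z in Z + _]mulr_sumr [Z in _ + Z]mulr_sumr -big_split /=.
by apply: eq_bigr => k _; ring.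
Qed.

Lemma jacobian_form_ge0 c x v : (forall k, 0 <= x k) -> 0 < total x ->
  0 <= Theta c (total x) -> 0 <= Delta n c (total x) ->
  0 <= jacobian_form c x v.
Proof.
move=> x0 X0 T0 D0; have g2 := gamma_ge2.
have gX : 0 < (gamma n + 2) * total x by rewrite mulr_gt0 //; lra.
rewrite -(pmulr_rge0 _ gX) jacobian_form_cone.
apply: sumr_ge0 => k _; rewrite mulr_ge0 // addr_ge0 // mulr_ge0 //.
  exact: vertex_form_gamma_ge0.
exact: vertex_formN2_ge0.
Qed.

(** Both vertex forms enter with a weight at least [e], and their combination
    with weights 2 and [gamma n] is [gamma n + 2] times
    [total v ^+ 2 + dot v v]. *)
Lemma jacobian_form_ge c x v (e : R) : (forall k, 0 <= x k) -> 0 < total x ->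
  0 <= e -> e <= Theta c (total x) -> e <= Delta n c (total x) ->
  e / gamma n * dot v v <= jacobian_form c x v.
Proof.
move=> x0 X0 e0 Te De; have g2 := gamma_ge2.
have g0 : 0 < gamma n :> R by lra.
have gX : 0 < (gamma n + 2) * total x by rewrite mulr_gt0 //; lra.
rewrite -(ler_pM2l gX) jacobian_form_cone.
have -> : (gamma n + 2) * total x * (e / gamma n * dot v v) =
    \sum_(k < n) x k * ((gamma n + 2) * (e / gamma n * dot v v)).
  by rewrite -mulr_suml -/(total x); ring.
apply: ler_sum => k _; rewrite ler_wpM2l //.
have A0 := vertex_form_gamma_ge0 v k; have B0 := vertex_formN2_ge0 v k.
have := ler_wpM2r A0 Te; have := ler_wpM2r B0 De.
suff : (gamma n + 2) * (e / gamma n * dot v v) <=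
    e * (vertex_form (gamma n) v k + vertex_form (-2) v k).
  by rewrite mulrDr; lra.
rewrite (_ : _ * (_ * _) = e * ((gamma n + 2) * dot v v / gamma n)); last by ring.
rewrite ler_wpM2l // ler_pdivrMr //.
have V0 := sqr_ge0 (total v).
suff : (gamma n + 2) * dot v v <=
   2 * vertex_form (gamma n) v k + gamma n * vertex_form (-2) v k by nra.
by rewrite /vertex_form; nra.
Qed.

(** If the form vanished, then [vertex_form (gamma n) v k] would vanish for every
    [k] with positive load, so that [v k * total v <= 0] for all [k]. Summing over
    [k] gives [total v = 0], and then the vertex form is [dot v v]. The support
    condition holds in the interior of a segment of nonnegative vectors. *)
Lemma jacobian_form_gt0 c x v : (forall k, 0 <= x k) -> 0 < total x ->
  (forall k, x k = 0 -> v k = 0) -> 0 < dot v v ->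
  0 < Theta c (total x) -> 0 <= Delta n c (total x) ->
  0 < jacobian_form c x v.
Proof.
move=> x0 X0 supp v0 T0 D0; have g2 := gamma_ge2; have T0' := ltW T0.
have gX : 0 < (gamma n + 2) * total x by rewrite mulr_gt0 //; lra.
rewrite lt_def jacobian_form_ge0 ?andbT // ?ltW //; apply/eqP => J0.
have := jacobian_form_cone c x v; rewrite J0 mulr0 => /esym/psumr_eq0P H.
have {}H k : 0 < x k -> vertex_form (gamma n) v k = 0.
  move=> xk; have A0 := vertex_form_gamma_ge0 v k; have B0 := vertex_formN2_ge0 v k.
  have /eqP : x k * (Theta c (total x) * vertex_form (gamma n) v k +
         Delta n c (total x) * vertex_form (-2) v k) = 0.
    apply: H => // j _; rewrite mulr_ge0 // addr_ge0 // mulr_ge0 //.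
      exact: vertex_form_gamma_ge0.
    exact: vertex_formN2_ge0.
  rewrite mulf_eq0 gt_eqF //= paddr_eq0 ?mulr_ge0 // mulf_eq0 (gt_eqF T0) /=.
  by case/andP => /eqP.
have V0 := sqr_ge0 (total v).
have neg k : v k * total v <= 0.
  have [/supp->|xk] := eqVneq (x k) 0; first by rewrite mul0r.
  have xk0 : 0 < x k by rewrite lt_def xk x0.
  by have := H k xk0; rewrite /vertex_form; nra.
have V2 : total v ^+ 2 <= 0.
  by rewrite expr2 {1}/total mulr_suml; apply: sumr_le0 => k _; exact: neg.
have Vz : total v = 0 by apply/eqP; rewrite -sqrf_eq0 eq_le V2 sqr_ge0.
have [k xk] : exists k, 0 < x k.
  apply/not_existsP => xN; move: X0; rewrite /total big1 ?ltxx // => k _.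
  by apply/eqP; rewrite eq_le x0 andbT leNgt; apply/negP/xN.
have := H k xk; rewrite /vertex_form Vz expr0n mulr0 add0r addr0 => vv.
by rewrite vv ltxx in v0.
Qed.

End QuadraticForm.

(** * Bounds on the gap of a single resource *)

Section OneResource.
Context {R : realType} {n : nat}.
Context (n_gt1 : (1 < n)%N).
Implicit Types (v x y : 'I_n -> R) (c : R -> R).

(** By the mean value theorem the gap is the Jacobian form at an interior point of
    the segment, whose load is positive and lies between those of the ends. *)
Lemma resource_gap_ge c x y (mu : R) : C2_plus c ->
  (forall i, 0 <= x i) -> (forall i, 0 <= y i) ->
  (forall z v, (forall i, 0 <= z i) -> 0 < total z ->
     total z <= Num.max (total x) (total y) -> mu * dot v v <= jacobian_form c z v) ->
  mu * dot (diff x y) (diff x y) <= resource_gap c x y.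
Proof.
move=> c2 x0 y0 H; have [->|xy] := pselect (x = y).
  rewrite resource_gap_diag /dot big1 ?mulr0 // => i _.
  by rewrite /diff subrr mul0r.
have v0 := dot_diff_gt0 xy.
have x1 : forall i, 0 <= ray y (diff x y) 1 i by rewrite ray_diff.
have [t t01] := resource_gap_MVT c2 y0 x1 v0; rewrite ray_diff => ->.
have [X0 z0] := total_ray_gt0 y0 x1 v0 t01; apply: H => //.
case/andP: t01 => t0 t1.
have := total_ray y (diff x y) 1; rewrite ray_diff mul1r total_ray le_max => ->.
by case: (leP 0 (total (diff x y))) => V; apply/orP; [left|right]; nra.
Qed.

Lemma resource_gap_ge0 c x y : Q_class n c ->
  (forall i, 0 <= x i) -> (forall i, 0 <= y i) -> 0 <= resource_gap c x y.
Proof.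
move=> [[c2 cT] cD] x0 y0; rewrite -[0](mul0r (dot (diff x y) (diff x y))).
apply: resource_gap_ge => // z v z0 Z0 _; rewrite mul0r.
apply: jacobian_form_ge0 => //; first by have [] := cT _ (ltW Z0).
exact/cD/ltW.
Qed.

Lemma resource_gap_strong c (M : R) : Q_sm_class n c -> 0 <= M ->
  exists2 mu : R, 0 < mu & forall x y : 'I_n -> R,
    (forall i, 0 <= x i) -> (forall i, 0 <= y i) ->
    total x <= M -> total y <= M ->
    mu * dot (diff x y) (diff x y) <= resource_gap c x y.
Proof.
move=> [[c2 _] cS] M0.
have [|e1 e10 H1] := within_Rplus_lower_bound M0 (Theta_continuous c2).
  by move=> s s0; have [] := cS s s0.
have [|e2 e20 H2] := within_Rplus_lower_bound M0 (Delta_continuous (n := n) c2).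
  by move=> s s0; have [] := cS s s0.
have g2 := gamma_ge2 (R := R) n_gt1.
exists (Num.min e1 e2 / gamma n).
  by rewrite divr_gt0 ?lt_min ?e10 //; lra.
move=> x y x0 y0 xM yM; apply: resource_gap_ge => // z v z0 Z0 ZM.
have zM : 0 <= total z <= M.
  by rewrite ltW //= (le_trans ZM) // ge_max xM yM.
apply: jacobian_form_ge => //; first by rewrite le_min !ltW.
- by rewrite ge_min H1.
- by rewrite ge_min H2 // orbT.
Qed.

(** As [Theta c >= 0], the map [x ^+ 2 * c' (x)] is nondecreasing. So a zero of the
    derivative at [s] forces [c' = 0] on [(0, s]], and there the marginal cost is
    constant. *)
Lemma mc_si_deriv_gt0 c (s : R) : mc_si_class c -> 0 < s -> 0 < deriv_plus c s.
Proof.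
move=> [[c2 cT] mc] s0; have [d0 _] := cT s (ltW s0).
rewrite lt_def d0 andbT; apply/eqP => ds.
have [c0 c1 _] := C2_continuous c2.
have dz r : 0 < r <= s -> deriv_plus c r = 0.
  case/andP => r0; rewrite le_eqVlt => /orP[/eqP->//|rs].
  pose h (w : R) := w * w * deriv_plus c w.
  have [|x x0|z /andP[rz zs]] := @MVT_Rplus R h (fun w => w * Theta c w) r s (ltW r0) rs.
  - apply: within_continuousM => //; apply: within_continuousM;
      by apply: continuous_subspaceT => ?; exact: cvg_id.
  - have [_ d2] := C2_is_derive c2 x0.
    have did := is_derive_id x 1.
    apply: (is_derive_eq (is_derive1M_fun (is_derive1M_fun did did) d2)).
    by rewrite /Theta; ring.
  rewrite /h ds mulr0 sub0r => E.
  have z0 : 0 < z by exact: lt_trans rz.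
  have [_ Tz] := cT z (ltW z0).
  have : 0 <= z * Theta c z * (s - r) by rewrite !mulr_ge0 ?subr_ge0 // ltW.
  rewrite -E oppr_ge0 => H; have [dr _] := cT r (ltW r0).
  by apply/eqP; rewrite eq_le dr andbT -(pmulr_rle0 _ (mulr_gt0 r0 r0)).
have hs : 0 < s / 2 by rewrite divr_gt0.
have hss : s / 2 < s by lra.
have [|z /andP[z1 z2] E] := @MVT_Rplus R c (deriv_plus c) (s / 2) s (ltW hs) hss c0.
  by move=> x /(C2_is_derive c2)[].
rewrite dz in E; last by rewrite ltW // andbT; lra.
have := mc true false (s / 2) s (ltW hs) (ltW s0) hss (s / 2) s.
rewrite !in_itv /= !lexx (ltW hss) => /(_ isT isT hss).
by rewrite /marginal_cost ds dz ?hs ?ltW //; lra.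
Qed.

Lemma mc_si_Theta_gt0 c (a b : R) : mc_si_class c -> 0 <= a -> a < b ->
  exists2 s, a < s < b & 0 < Theta c s.
Proof.
move=> [[c2 cT] mc] a0 ab.
have b0 : 0 <= b by apply: le_trans a0 (ltW ab).
have [|s sab E] :=
  @MVT_Rplus R _ (Theta c) a b a0 ab (marginal_cost_continuous c2).
  by move=> x; exact: marginal_cost_is_derive.
exists s => //; have := mc true false a b a0 b0 ab a b.
rewrite !in_itv /= !lexx (ltW ab) => /(_ isT isT ab).
by rewrite -subr_gt0 E pmulr_lgt0 // subr_gt0.
Qed.

(** The directional cost is nondecreasing along the segment, so one point where
    its derivative is positive suffices. If the load is constant, the Jacobian
    form is [c' (X) * dot v v], and [c' (X) > 0]. Otherwise the load sweeps a
    non-degenerate interval, which contains a point where [Theta] is positive. *)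
Lemma resource_gap_gt0 c x y : Q_class n c -> mc_si_class c ->
  (forall i, 0 <= x i) -> (forall i, 0 <= y i) -> x <> y ->
  0 < resource_gap c x y.
Proof.
move=> cQ cm x0 y0 xy; have [[c2 cT] cD] := cQ.
have v0 := dot_diff_gt0 xy; set v := diff x y in v0.
have r1 : ray y v 1 = x by exact: ray_diff.
have x1 : forall i, 0 <= ray y v 1 i by rewrite r1.
have pos t : 0 < t < 1 -> 0 < total (ray y v t) by move=> /(total_ray_gt0 y0 x1 v0)[].
have nng t : 0 < t < 1 -> forall i, 0 <= ray y v t i.
  by move=> /(total_ray_gt0 y0 x1 v0)[].
rewrite -r1 resource_gap_ray mul1r subr_gt0.
have [V0|V0] := eqVneq (total v) 0.
  have [t t01 ] := resource_gap_MVT c2 y0 x1 v0.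
  rewrite resource_gap_ray mul1r -subr_gt0 => ->.
  rewrite /jacobian_form V0 expr0n add0r mulr0 mul0r addr0.
  by rewrite mulr_gt0 // mc_si_deriv_gt0 // pos.
have [t t01 Tt] : exists2 t, 0 < t < 1 & 0 < Theta c (total (ray y v t)).
  have Y0 : 0 <= total y by exact: sumr_ge0.
  have X0 : 0 <= total x by exact: sumr_ge0.
  have XE : total x = total y + total v by rewrite -{1}r1 total_ray mul1r.
  have {cQ cT cD} [s sab Ts] : exists2 s, Num.min (total x) (total y) < s <
      Num.max (total x) (total y) & 0 < Theta c s.
    apply: mc_si_Theta_gt0 => //; first by rewrite le_min X0.
    rewrite gt_min !lt_max !ltxx orbF /= -neq_lt -subr_eq0 XE.
    by rewrite addrAC subrr add0r.
  (* The time at which the load of the segment is s. *)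
  exists ((s - total y) / total v); last first.
    by rewrite total_ray divfK // addrC subrK.
  move: sab; rewrite XE; case: (ltrgtP (total v) 0) V0 => // V _.
    rewrite min_l ?max_r ?gerDl ?(ltW V) // => /andP[s1 s2].
    by rewrite -(ltr_nM2r V) mul0r -[_ / _ < 1](ltr_nM2r V) divfK ?lt_eqF // mul1r; lra.
  rewrite min_r ?max_l ?lerDl ?(ltW V) // => /andP[s1 s2].
  by rewrite divr_gt0 ?subr_gt0 //= ltr_pdivrMr // mul1r; lra.
apply: (@increasing_of_derive _ _ (fun s => jacobian_form c (ray y v s) v) t) => //.
- exact: directional_cost_continuous.
- move=> s s01; have p := pos s s01; split; first exact: directional_cost_is_derive.
  apply: jacobian_form_ge0 => //; [exact: nng|by have [] := cT _ (ltW p)|exact/cD/ltW].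
- apply: jacobian_form_gt0 => //; [exact: nng|exact: pos| |exact/cD/ltW/pos].
  move=> k; have := y0 k; have := x1 k; rewrite /ray; case/andP: t01 => t0 t1.
  by move=> ? ? ?; nra.
Qed.

End OneResource.

(** * Games as sums of resources *)

Section Games.
Context {R : realType} {n : nat}.
Implicit Types (c : R -> R) (M : R).

Definition box (T : Type) M : set (T -> R) := [set u | forall e, 0 <= u e <= M].

Lemma box_convex (T : Type) M :
  convex_set (@box T M : set (convex_lmodType (T -> R^o))).
Proof.
move=> x y l /set_mem xB /set_mem yB; apply/mem_set => e.
have /andP[x0 x1] := xB e; have /andP[y0 y1] := yB e.
have l0 : 0 <= l%:num by []. have l1 : l%:num <= 1 by [].
rewrite (_ : conv l x y e = l%:num * x e + (1 - l%:num) * y e) //.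
by apply/andP; split; nra.
Qed.

Lemma box_compact (T : eqType) M : compact (@box T M : set {ptws T -> R}).
Proof.
have := @tychonoff T (fun=> R) (fun=> `[0, M]%classic) (fun=> @segment_compact R 0 M).
by congr (compact _); apply/seteqP; split => u uB e; have := uB e; rewrite /= in_itv.
Qed.

Definition one_resource_game c M (hc : cost_class c) : congestion_game R n :=
  @CongestionGame R n unit (fun=> box M) (fun=> c)
    (fun _ u uB e => proj1 (andP (uB e))) (fun=> @box_convex unit M)
    (fun=> @box_compact unit M) (fun=> hc).

Context (G : congestion_game R n).
Implicit Types x y : profile G.

Lemma VI_gap_sum x y :
  VI_gap x y = \sum_e resource_gap (cost G e) (x^~ e) (y^~ e).
Proof. by rewrite /VI_gap /inner exchange_big. Qed.

Lemma enorm_sqr x y : enorm (sub_profile x y) ^+ 2 =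
  \sum_e dot (diff (x^~ e) (y^~ e)) (diff (x^~ e) (y^~ e)).
Proof.
rewrite /enorm sqr_sqrtr; first by rewrite /inner exchange_big.
by apply: sumr_ge0 => i _; apply: sumr_ge0 => e _; rewrite -expr2 sqr_ge0.
Qed.

Lemma feasible_ge0 x i e : feasible x -> 0 <= x i e.
Proof. by move=> fx; exact: strategies_ge0 (fx i) e. Qed.

Lemma strategy_bounded i e : exists M, forall u, strategies G i u -> u e <= M.
Proof.
have ck := @strategies_compact R n G i.
have : compact (proj e @` (strategies G i : set {ptws resource G -> R})).
  apply: continuous_compact ck; apply: continuous_subspaceT.
  exact: proj_continuous.
move=> /compact_bounded[M [_ HM]]; exists (M + 1) => u Su.
apply: le_trans (ler_norm _) _; apply: HM; first by rewrite ltrDl.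
by exists u.
Qed.

Lemma load_bounded : exists2 M, 0 <= M & forall x, feasible x ->
  forall e, total (x^~ e) <= M.
Proof.
have /choice[B HB] : forall p : 'I_n * resource G,
    exists M, forall u, strategies G p.1 u -> u p.2 <= M.
  by case=> i e; exact: strategy_bounded.
exists (\sum_(e : resource G) \sum_(i < n) `|B (i, e)|).
  by apply: sumr_ge0 => e _; exact: sumr_ge0.
move=> x fx e; rewrite (bigD1 e) //= -[leLHS]addr0; apply: lerD.
  by apply: ler_sum => i _; apply: le_trans (ler_norm _); exact: HB (i, e) _ (fx i).
by apply: sumr_ge0 => e' _; exact: sumr_ge0.
Qed.

End Games.

(** * Sufficiency *)

Section Universal.
Context {R : realType} {n : nat}.
Context (n_gt1 : (1 < n)%N).
Context (C : set (R -> R)).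

Lemma Q_class_monotone : C `<=` Q_class n -> VI_monotone n C.
Proof.
move=> CQ G GC x y fx fy; rewrite VI_gap_sum; apply: sumr_ge0 => e _.
by apply: resource_gap_ge0 => //; [exact/CQ/GC|move=> i|move=> i]; exact: feasible_ge0.
Qed.

(** All resources have a nonnegative gap, and two distinct profiles differ on
    some resource, whose gap is positive. *)
Lemma Q_mc_si_strictly_monotone :
  C `<=` Q_class n `&` mc_si_class -> strictly_VI_monotone n C.
Proof.
move=> CQ G GC x y fx fy xy; rewrite VI_gap_sum.
have g0 e : 0 <= resource_gap (cost G e) (x^~ e) (y^~ e).
  have [cQ _] := CQ _ (GC e).
  by apply: resource_gap_ge0 => // i; exact: feasible_ge0.
rewrite lt_def sumr_ge0 // andbT; apply/eqP => /psumr_eq0P H.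
apply: xy; apply/funext => i; apply/funext => e.
have [xye|xye] := pselect (x^~ e = y^~ e); first by move/(congr1 (fun f => f i)): xye.
have [cQ cm] := CQ _ (GC e).
suff : 0 < resource_gap (cost G e) (x^~ e) (y^~ e) by rewrite H ?ltxx.
by apply: resource_gap_gt0 => // j; exact: feasible_ge0.
Qed.

(** Compactness of the strategy sets bounds the loads, and finiteness of the
    resource set allows one constant to serve all resources. *)
Lemma Q_sm_strongly_monotone : C `<=` Q_sm_class n -> strongly_VI_monotone n C.
Proof.
move=> CQ G GC; have [M M0 HM] := load_bounded G.
have /choice[mu Hmu] : forall e : resource G, exists mu : R, 0 < mu /\
    forall x y : 'I_n -> R, (forall i, 0 <= x i) -> (forall i, 0 <= y i) ->
    total x <= M -> total y <= M ->
    mu * dot (diff x y) (diff x y) <= resource_gap (cost G e) x y.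
  by move=> e; have [m m0 Hm] := resource_gap_strong n_gt1 (CQ _ (GC e)) M0; exists m.
exists (\big[Num.min/1]_e mu e).
  by apply: lt_bigmin => [|e _]; [exact: ltr01|case: (Hmu e)].
move=> x y fx fy; rewrite enorm_sqr VI_gap_sum mulr_sumr; apply: ler_sum => e _.
have [_ He] := Hmu e.
apply: le_trans (He _ _ _ _ (HM x fx e) (HM y fy e)).
- by rewrite ler_wpM2r ?dot_ge0 // bigmin_le.
- by move=> i; exact: feasible_ge0.
- by move=> i; exact: feasible_ge0.
Qed.

End Universal.

(** * Necessity *)

Section Necessity.
Context {R : realType} {n : nat}.
Context (n_gt1 : (1 < n)%N).
Implicit Types (x y v : 'I_n -> R) (c : R -> R) (M mu s : R).

Definition one_resource_profile x : 'I_n -> unit -> R := fun i _ => x i.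

(** The common content of the three notions of monotonicity for the one-resource
    game on [box M], with [mu = 0] for plain monotonicity. *)
Definition monotone_on_box c M mu : Prop := forall x y,
  (forall i, 0 <= x i <= M) -> (forall i, 0 <= y i <= M) ->
  mu * dot (diff x y) (diff x y) <= resource_gap c x y.

Lemma one_resource_VI_gap c M (hc : cost_class c) x y :
  @VI_gap R n (one_resource_game M hc) (one_resource_profile x)
    (one_resource_profile y) = resource_gap c x y.
Proof. by rewrite VI_gap_sum (bigD1 tt) //= big1 ?addr0 // => -[]. Qed.

Lemma one_resource_enorm c M (hc : cost_class c) x y :
  @enorm R n (one_resource_game M hc)
    (@sub_profile R n (one_resource_game M hc) (one_resource_profile x)
       (one_resource_profile y)) ^+ 2 = dot (diff x y) (diff x y).
Proof. by rewrite enorm_sqr (bigD1 tt) //= big1 ?addr0 // => -[]. Qed.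

Lemma one_resource_profile_feasible c M (hc : cost_class c) x :
  (forall i, 0 <= x i <= M) ->
  @feasible R n (one_resource_game M hc) (one_resource_profile x).
Proof. by move=> xM i e; exact: xM. Qed.

Let k0 : 'I_n := Ordinal (ltnW n_gt1).

Definition single s : 'I_n -> R := fun i => if i == k0 then s else 0.
(** The equality case of [vertex_form_gamma_ge0]: the player [k0] gives up
    [n - 1] units, and each of the [n - 1] others takes 2 units, that is, twice
    in total what [k0] gives up. *)
Definition push_out : 'I_n -> R := fun i => if i == k0 then - (n%:R - 1) else 2.

Lemma sum_single s (F : 'I_n -> R) : \sum_(i < n) single s i * F i = s * F k0.
Proof.
rewrite (bigD1 k0) //= /single eqxx big1 ?addr0 // => i /negPf->.
by rewrite mul0r.
Qed.

Lemma total_single s : total (single s) = s.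
Proof.
rewrite -[RHS]mulr1 -(sum_single s (fun=> 1)).
by apply: eq_bigr => i _; rewrite mulr1.
Qed.

Lemma dot_single s v : dot (single s) v = s * v k0.
Proof. exact: sum_single. Qed.

Lemma sum_push_out (h : R -> R) :
  \sum_(i < n) h (push_out i) = h (- (n%:R - 1)) + h 2 * (n%:R - 1).
Proof.
rewrite (bigD1 k0) //= {1}/push_out eqxx; congr (_ + _).
rewrite -(sum_others_const n_gt1 _ k0).
by apply: eq_bigr => i /negPf ik; rewrite /push_out ik.
Qed.

Lemma total_push_out : total push_out = n%:R - 1.
Proof. by rewrite /total (sum_push_out id); ring. Qed.

Lemma dot_push_out : dot push_out push_out = (n%:R - 1) ^+ 2 + 4 * (n%:R - 1).
Proof. by rewrite /dot (sum_push_out (fun r => r * r)); ring. Qed.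

(** When [k0] carries the whole load, this direction isolates [Delta n]. *)
Lemma jacobian_form_push_out c s :
  jacobian_form c (single s) push_out = (n%:R - 1) ^+ 2 * Delta n c s.
Proof.
rewrite /jacobian_form total_single dot_single total_push_out dot_push_out.
rewrite /Delta /push_out eqxx [RHS]mulrBr [in RHS]mulrA.
have -> : (n%:R - 1) ^+ 2 * gamma n = (n%:R - 1) * (gamma n * (n%:R - 1)) :> R by ring.
by rewrite gammaE //; ring.
Qed.

Lemma jacobian_form_single c s :
  jacobian_form c (single s) (single 1) = Theta c s.
Proof.
by rewrite /jacobian_form !total_single !dot_single /single eqxx /Theta; ring.
Qed.

Lemma jacobian_form_ge_box c M mu x v (e : R) : C2_plus c ->
  monotone_on_box c M mu -> 0 < total x -> 0 < e ->
  (forall i, 0 <= x i <= M) ->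
  (forall t, 0 < t < e -> forall i, 0 <= ray x v t i <= M) ->
  mu * dot v v <= jacobian_form c x v.
Proof.
move=> c2 cM X0 e0 xM rM; apply: (jacobian_form_ge_gap c2 X0 e0) => t te.
apply: le_trans (cM _ _ (rM t te) xM).
have -> : dot (diff (ray x v t) x) (diff (ray x v t) x) = t ^+ 2 * dot v v.
  by rewrite /dot mulr_sumr; apply: eq_bigr => i _; rewrite /diff /ray; ring.
by rewrite mulrA.
Qed.

(** The deviation [push_out] stays in the box for small times, since [k0] starts
    with the load [s > 0] and the others start from 0. *)
Lemma monotone_on_box_Delta c M mu s : C2_plus c -> monotone_on_box c M mu ->
  0 < s < M ->
  mu * ((n%:R - 1) ^+ 2 + 4 * (n%:R - 1)) <= (n%:R - 1) ^+ 2 * Delta n c s.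
Proof.
move=> c2 cM /andP[s0 sM].
have n1 : 0 < n%:R - 1 :> R by rewrite subr_gt0 ltr1n.
rewrite -jacobian_form_push_out -dot_push_out.
(* Player k0 runs out of load at s / (n - 1); the others reach M at M / 2. *)
apply: (jacobian_form_ge_box (e := Num.min (s / (n%:R - 1)) (M / 2)) c2 cM).
- by rewrite total_single.
- by rewrite lt_min !divr_gt0 //; lra.
- by move=> i; rewrite /single; case: ifP => _; apply/andP; split; lra.
move=> t /andP[t0]; rewrite lt_min ltr_pdivlMr // => /andP[t1 t2] i.
by rewrite /ray /single /push_out; case: ifP => _; apply/andP; split; nra.
Qed.

Lemma monotone_on_box_Theta c M mu s : C2_plus c -> monotone_on_box c M mu ->
  0 < s < M -> mu <= Theta c s.
Proof.
move=> c2 cM /andP[s0 sM].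
have d1 : dot (single 1) (single 1) = 1 by rewrite dot_single mul1r /single eqxx.
rewrite -[mu]mulr1 -d1 -jacobian_form_single.
apply: (jacobian_form_ge_box (e := M - s) c2 cM).
- by rewrite total_single.
- by rewrite subr_gt0.
- by move=> i; rewrite /single; case: ifP => _; apply/andP; split; lra.
move=> t /andP[t0 t1] i.
by rewrite /ray /single; case: ifP => _; apply/andP; split; lra.
Qed.

Context (C : set (R -> R)).
Context (C_cost : C `<=` cost_class).

(** At [s > 0] the deviation [push_out] gives [0 <= Delta n c s]; at 0, [Delta n c]
    is [gamma n * c' (0)]. *)
Lemma monotone_sub_Q_class : VI_monotone n C -> C `<=` Q_class n.
Proof.
move=> mC c Cc; have hc := C_cost Cc; split=> // s.
have [c2 cT] := hc; rewrite /Rplus /= le_eqVlt => /orP[/eqP<-|s0].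
  rewrite /Delta mul0r subr0 mulr_ge0 //; last by have [] := cT 0 (lexx _).
  by have := gamma_ge2 (R := R) n_gt1; lra.
have n1 : 0 < n%:R - 1 :> R by rewrite subr_gt0 ltr1n.
rewrite -(pmulr_rge0 _ (exprn_gt0 2 n1)).
rewrite -[leLHS](mul0r ((n%:R - 1) ^+ 2 + 4 * (n%:R - 1))).
apply: (monotone_on_box_Delta (M := s + 1) c2); last by rewrite s0 ltrDl ltr01.
move=> x y xM yM; rewrite mul0r -(one_resource_VI_gap (s + 1) hc).
by apply: mC => //; exact: one_resource_profile_feasible.
Qed.

Lemma strictly_monotone_monotone : strictly_VI_monotone n C -> VI_monotone n C.
Proof.
move=> sC G GC x y fx fy; have [->|xy] := pselect (x = y).
  by rewrite VI_gap_sum sumr_ge0 // => e _; rewrite resource_gap_diag.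
by apply/ltW/sC.
Qed.

Lemma resource_gap_single c r s : resource_gap c (single r) (single s) =
  (marginal_cost c r - marginal_cost c s) * (r - s).
Proof.
rewrite /resource_gap !total_single (bigD1 k0) //= big1 => [|i /negPf ik].
  by rewrite addr0 /single eqxx.
by rewrite /single ik subrr mulr0.
Qed.

(** When only one player uses the resource, the gap compares marginal costs. *)
Lemma strictly_monotone_sub_mc_si :
  strictly_VI_monotone n C -> C `<=` mc_si_class.
Proof.
move=> sC c Cc; have hc := C_cost Cc; split=> // l r a b a0 b0 ab x y xI _ xy.
have x0 : 0 <= x.
  apply: le_trans a0 _; move: xI; rewrite itv_boundlr => /andP[+ _].
  by case: (l); rewrite bnd_simp // => /ltW.
have bx z : z <= y -> 0 <= z -> forall i, 0 <= single z i <= y.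
  by move=> zy z0 i; rewrite /single; case: ifP => _; apply/andP; split; lra.
have : 0 < resource_gap c (single y) (single x).
  rewrite -(one_resource_VI_gap y hc); apply: sC => //.
  - by apply/one_resource_profile_feasible/bx => //; lra.
  - by apply/one_resource_profile_feasible/bx => //; lra.
  - move=> /(congr1 (fun p => p k0 tt)).
    by rewrite /one_resource_profile /single eqxx => E; rewrite E ltxx in xy.
by rewrite resource_gap_single pmulr_lgt0 ?subr_gt0.
Qed.

(** At [s > 0] this is the bound on the form in the directions [push_out] and
    [single 1]. The constant of one game bounds [Theta] from below on a whole
    interval, so that [Theta c 0 = 2 * c' (0)] is positive as well. *)
Lemma strongly_monotone_sub_Q_sm : strongly_VI_monotone n C -> C `<=` Q_sm_class n.
Proof.
move=> sC c Cc; have hc := C_cost Cc; have [c2 _] := hc.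
have box M : exists2 mu, 0 < mu & monotone_on_box c M mu.
  have [mu mu0 H] := sC (one_resource_game M hc) (fun=> Cc).
  exists mu => // x y xM yM.
  rewrite -(one_resource_VI_gap M hc) -(one_resource_enorm M hc).
  by apply: H; exact: one_resource_profile_feasible.
have n1 : 0 < n%:R - 1 :> R by rewrite subr_gt0 ltr1n.
split=> // s; rewrite /Rplus /= le_eqVlt => /orP[/eqP<-|s0].
  (* Any bound above 1 works: the loads in (0, 1] must be interior to the box. *)
  have [mu mu0 cM] := box 2.
  have T0 : mu <= Theta c 0.
    apply: within_Rplus_ge_at0; first exact: Theta_continuous.
    move=> s' /andP[s0 s1]; apply: (monotone_on_box_Theta c2 cM).
    by rewrite s0 /=; lra.
  have := gamma_ge2 (R := R) n_gt1.
  by move: T0; rewrite /Delta /Theta !mul0r subr0 addr0 => T0 g2; split; nra.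
have [mu mu0 cM] := box (s + 1).
have sM : 0 < s < s + 1 by rewrite s0 ltrDl ltr01.
split; last by apply: lt_le_trans mu0 _; exact: monotone_on_box_Theta cM sM.
rewrite -(pmulr_rgt0 _ (exprn_gt0 2 n1)).
apply: lt_le_trans (monotone_on_box_Delta c2 cM sM).
by rewrite mulr_gt0 // addr_gt0 ?exprn_gt0 // mulr_gt0.
Qed.

End Necessity.

Theorem theorem1 (R : realType) (n : nat) (hn : (2 <= n)%N)
    (C : set (R -> R)) (hC : C `<=` cost_class) :
  [/\ VI_monotone n C <-> C `<=` Q_class n,
      strictly_VI_monotone n C <-> C `<=` Q_class n `&` mc_si_class &
      strongly_VI_monotone n C <-> C `<=` Q_sm_class n].
Proof.
split; split.
- exact: monotone_sub_Q_class.
- exact: Q_class_monotone.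
- move=> sC c Cc; split; last exact: (strictly_monotone_sub_mc_si hn hC sC).
  exact: (monotone_sub_Q_class hn hC (strictly_monotone_monotone sC)).
- exact: Q_mc_si_strictly_monotone.
- exact: strongly_monotone_sub_Q_sm.
- exact: Q_sm_strongly_monotone.
Qed.
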